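(* Suppose $G$ is a semidirect product $A \rtimes B$ of two cyclic groups (with $A$ normal), where $B$ has prime order $p$ and where $A$ has order $q^k$ for a prime $q$ not equal to $p$. If $G$ is freely representable, then $G$ is cyclic.
   Context: A free linear representation of a group $G$ over a field $F$ is a linear action of $G$ on an $F$-vector space $V \neq 0$ such that $gv \neq v$ for all $g \neq 1$ in $G$ and all nonzero $v \in V$. A finite group is freely representable if it has a free linear representation over $\mathbb{C}$. *)

(* Defs.v *)
From HB Require Import structures.
From mathcomp Require Import all_boot all_order all_algebra all_fingroup all_solvable.
From mathcomp Require Import complex.
From mathcomp Require Import reals.

Set Implicit Arguments.
Unset Strict Implicit.
Unset Printing Implicit Defensive.

Import GRing.Theory.
Local Open Scope ring_scope.

(* Only the values of [rho] on [G] are constrained.  The space [V] may be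
   infinite-dimensional. *)
Definition linear_action (F : fieldType) (gT : finGroupType) (G : {group gT})
    (V : lmodType F) (rho : gT -> {linear V -> V}) : Prop :=
  rho 1%g =1 id /\
  {in G &, forall g h, rho (g * h)%g =1 rho g \o rho h}.

Definition free_linear_repr (F : fieldType) (gT : finGroupType)
    (G : {group gT}) (V : lmodType F) (rho : gT -> {linear V -> V}) : Prop :=
  [/\ linear_action G rho,
      exists v : V, v != 0 &
      {in G, forall g, g != 1%g -> forall v : V, v != 0 -> rho g v != v}].

(* [R] is any model of the real numbers, so that [R[i]] is the field of complex
   numbers. *)
Definition freely_representable (R : realType) (gT : finGroupType)
    (G : {group gT}) : Prop :=
  exists (V : lmodType R[i]) (rho : gT -> {linear V -> V}),
    free_linear_repr G rho.

(* Main.v *)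
(** A free action kills every sum over a nontrivial subgroup, because such a sum
    is a vector fixed by that subgroup.  By coprimality [A, B] and C_A(B) meet
    trivially, so one of them is trivial, A being a cyclic q-group.  If B does not
    centralise A, then C_A(B) = 1, and a |-> b ^ a * b^-1 permutes A for every
    nontrivial b in B.  Computing \sum_a \sum_b (b ^ a) v in both orders then gives
    #|A| v = 0, which is absurd in characteristic 0. *)

Require Import Defs.
From HB Require Import structures.
From mathcomp Require Import all_boot all_order all_algebra all_fingroup all_solvable.
From mathcomp Require Import complex.
From mathcomp Require Import reals.

Set Implicit Arguments.
Unset Strict Implicit.
Unset Printing Implicit Defensive.

Import GRing.Theory.
Local Open Scope group_scope.

Lemma free_linear_repr_sum0 (F : fieldType) (gT : finGroupType)
    (G H : {group gT}) (V : lmodType F) (rho : gT -> {linear V -> V}) (v : V) :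
  free_linear_repr G rho -> H \subset G -> H :!=: 1 ->
  (\sum_(h in H) rho h v = 0)%R.
Proof.
move=> [[_ rhoM] _ free] sHG /trivgPn[x Hx nt_x].
apply/eqP; apply: contraT => /(free x (subsetP sHG x Hx) nt_x)/negP[].
rewrite linear_sum; apply/eqP; rewrite [RHS](reindex_inj (mulgI x)) /=.
apply: eq_big => [h|h Hh]; first by rewrite groupMl.
by rewrite rhoM ?(subsetP sHG).
Qed.

(** The map stays in [A] because its value is the commutator [a^-1 * a ^ b^-1]. It is injective
    because [b ^ a = b ^ c] puts [a * c^-1] in ['C_A[b]]; finiteness does the rest. *)
Lemma fixed_point_free_imset (gT : finGroupType) (A : {group gT}) (b : gT) :
  b \in 'N(A) -> 'C_A[b] = 1 -> [set b ^ a * b^-1 | a in A] = A.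
Proof.
move=> nAb cA1; apply/eqP; rewrite eqEcard; apply/andP; split.
  apply/subsetP=> _ /imsetP[a Aa ->].
  have -> : b ^ a * b^-1 = a^-1 * a ^ b^-1 by rewrite !conjgE invgK !mulgA.
  by rewrite groupM ?groupV // memJ_norm ?groupV.
rewrite card_in_imset // => a c Aa Ac /mulIg eq_ac.
apply/eqP; rewrite eq_mulgV1 -in_set1 -[[set 1]]cA1 inE groupM ?groupV //=.
by apply/cent1P/commute_sym/commgP/conjg_fixP; rewrite conjgM eq_ac conjgK.
Qed.

Lemma free_linear_repr_fixed_point_free (F : fieldType) (gT : finGroupType)
    (G A B : {group gT}) (V : lmodType F) (rho : gT -> {linear V -> V}) :
  free_linear_repr G rho -> A \subset G -> B \subset G -> B \subset 'N(A) ->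
  A :!=: 1 -> B :!=: 1 -> {in B^#, forall b, 'C_A[b] = 1} ->
  (#|A|%:R = 0 :> F)%R.
Proof.
move=> frep sAG sBG nAB ntA ntB cA1.
have [[rho1 rhoM] [v nz_v] _] := frep.
(* For fixed [a], the elements [b ^ a] run over the conjugate subgroup [B :^ a]. *)
have row0 a : a \in A -> (\sum_(b in B) rho (b ^ a)%g v = 0)%R.
  move=> Aa; rewrite -[RHS](free_linear_repr_sum0 (H := (B :^ a)%G) v frep).
  - rewrite [RHS](eq_bigl [in [set b ^ a | b in B]]) //.
    by rewrite big_imset //= => x y _ _ /conjg_inj.
  - by rewrite conj_subG ?(subsetP sAG).
  - by rewrite -!cardG_gt1 cardJg in ntB *.
(* For fixed [b], write [b ^ a = (b ^ a * b^-1) * b]: the first factor runs once over [A], so this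
   is the sum over [A] applied to [rho b v]. *)
have col0 b : b \in B^# -> (\sum_(a in A) rho (b ^ a)%g v = 0)%R.
  move=> B1b; have /setD1P[_ Bb] := B1b; have Gb := subsetP sBG b Bb.
  rewrite -[RHS](free_linear_repr_sum0 (rho b v) frep sAG ntA).
  have imA := fixed_point_free_imset (subsetP nAB b Bb) (cA1 b B1b).
  rewrite [RHS](eq_bigl [in [set b ^ a * b^-1 | a in A]]) => [|a]; last first.
    by rewrite imA.
  rewrite big_imset /=; last by apply/imset_injP; rewrite imA.
  apply: eq_bigr => a /(subsetP sAG) Ga.
  by rewrite -[RHS]/((rho _ \o rho b) v) -rhoM ?mulgKV ?groupM ?groupV ?groupJ.
have : (\sum_(a in A) \sum_(b in B) rho (b ^ a)%g v = 0)%R by rewrite big1.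
(* Only the column [b = 1] survives, and each of its [#|A|] terms is [v]. *)
rewrite exchange_big (bigD1 1) //= [X in (_ + X)%R]big1 ?addr0 => [|b]; last first.
  by case/andP=> Bb nt_b; rewrite col0 // !inE nt_b.
under eq_bigr do rewrite conj1g rho1.
rewrite sumr_const -scaler_nat => /eqP.
by rewrite scaler_eq0 (negPf nz_v) orbF => /eqP.
Qed.

Lemma cyclic_pgroup_cent_prime_compl (gT : finGroupType) (A B : {group gT})
    (q : nat) :
  cyclic A -> q.-group A -> prime #|B| -> coprime #|A| #|B| ->
  B \subset 'N(A) -> B \subset 'C(A) \/ {in B^#, forall b, 'C_A[b] = 1}.
Proof.
move=> cycA qA prB coAB nAB.
have abA := cyclic_abelian cycA.
have [sDA sCA] : [~: A, B] \subset A /\ 'C_A(B) \subset A.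
  by rewrite commg_subl subsetIl.
have sXA : [~: A, B] <*> 'C_A(B) \subset A by rewrite join_subG sDA.
have defX : [~: A, B] \x 'C_A(B) = [~: A, B] <*> 'C_A(B).
  apply: dprodEY; first exact: sub_abelian_cent2 abA _ _.
  by rewrite setIA (setIidPl sDA) (coprime_abel_cent_TI nAB coAB abA).
(* The product lies in [A], so it is again a cyclic [q]-group, and such a group has no two
   nontrivial direct factors. *)
have := cyclic_pgroup_dprod_trivg (pgroupS sXA qA) (cyclicS sXA cycA) defX.
case=> [[/commG1P cAB _] | [c1 _]]; first by left; rewrite centsC.
right=> b /setD1P[nt_b Bb]; rewrite -cent_cycle.
(* As [B] has prime order, [b] generates it, so centralising [b] amounts to centralising [B]. *)
suff -> : <[b]> = B by [].
apply/eqP; rewrite eqEcard cycle_subG Bb /= -orderE.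
by have /(prime_nt_dvdP prB)-> := order_dvdG Bb; rewrite ?order_eq1.
Qed.

Theorem lemma73 (R : realType) (gT : finGroupType) (G A B : {group gT})
    (p q k : nat) :
  A ><| B = G ->
  cyclic A -> cyclic B ->
  prime p -> #|B| = p ->
  prime q -> q != p -> #|A| = (q ^ k)%N ->
  freely_representable R G ->
  cyclic G.
Proof.
move=> defG cycA cycB prp oB prq neq_qp oA [V [rho frep]].
have [_ defAB nAB _] := sdprodP defG.
have coAB : coprime #|A| #|B|.
  by rewrite oA oB coprimeXl // prime_coprime // dvdn_prime2.
have qA : q.-group A by rewrite /pgroup oA pnatX pnat_id.
have [cAB | cA1] : B \subset 'C(A) \/ {in B^#, forall b, 'C_A[b] = 1}.
- by apply: cyclic_pgroup_cent_prime_compl qA _ _ _ => //; rewrite oB.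
- by rewrite (cyclic_dprod _ cycA cycB) // dprodEsd.
(* The case [k = 0] is allowed; then [G] is [B]. *)
have [A1 | ntA] := eqVneq (A : {set gT}) 1.
  by rewrite -defAB A1 mul1g.
have ntB : B :!=: 1 by rewrite -cardG_gt1 oB prime_gt1.
have [sAG sBG] : A \subset G /\ B \subset G by rewrite -defAB mulG_subl mulG_subr.
have /eqP := free_linear_repr_fixed_point_free frep sAG sBG nAB ntA ntB cA1.
by rewrite Num.Theory.pnatr_eq0 eqn0Ngt cardG_gt0.
Qed.
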